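(* Let $\mathbb{A}$ be a finite nonempty set and let $x\in \mathbb{A}^{\mathbb{N}}$ be an infinite word. Then $p_x(n)=O(n)$ if and only if there exists a language $S\subseteq \mathbb{A}^*$ of bounded complexity (i.e., $\limsup_{n\to\infty} p_S(n)<+\infty$) such that $\mathrm{Fac}(x)\subseteq S^2$.
   Context: $\mathbb{A}^*$ is the free monoid of all finite words over $\mathbb{A}$ (including the empty word $\varepsilon$) under concatenation; a language is a subset of $\mathbb{A}^*$. For a language $L$, $p_L(n)$ is the number of words of length $n$ in $L$. For an infinite word $x=x_0x_1x_2\cdots$, $\mathrm{Fac}(x)$ is the set of all finite blocks $x_ix_{i+1}\cdots x_j$ ($0\le i\le j$) together with $\varepsilon$, and $p_x(n)=p_{\mathrm{Fac}(x)}(n)$ is the factor complexity of $x$. For $S\subseteq\mathbb{A}^*$, $S^2=\{uv : u,v\in S\}$. *)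

(* Defs.v *)
From mathcomp Require Import all_boot all_order all_algebra.
From mathcomp Require Import all_classical all_reals all_analysis.

Set Implicit Arguments.
Unset Strict Implicit.
Unset Printing Implicit Defensive.

Import Order.TTheory GRing.Theory Num.Theory.
Import numFieldNormedType.Exports.

Local Open Scope classical_set_scope.

Definition language (A : finType) := set (seq A).

Definition complexity (A : finType) (L : language A) (n : nat) : nat :=
  #|[pred w : n.-tuple A | tval w \in L]|.

(* [[seq x k | k <- index_iota i j.+1]] is the block x_i x_(i+1) ... x_j,
   with both ends included. *)
Definition Fac (A : finType) (x : nat -> A) : language A :=
  [set w | w = [::] \/
     exists i j : nat, (i <= j)%N /\ w = [seq x k | k <- index_iota i j.+1]].

Definition factor_complexity (A : finType) (x : nat -> A) : nat -> nat :=
  complexity (Fac x).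

Definition lang_sqr (A : finType) (S : language A) : language A :=
  [set u ++ v | u in S & v in S].

Definition bounded_complexity (R : realType) (A : finType) (S : language A) :
    Prop :=
  (limn_esup (fun n => ((complexity S n)%:R : R)%:E) < +oo)%E.

(* Main.v *)
Require Import Defs.
From mathcomp Require Import all_boot all_order all_algebra.
From mathcomp Require Import all_classical all_reals all_analysis.
From mathcomp Require Import zify.

Import Order.TTheory GRing.Theory Num.Theory.
Import numFieldNormedType.Exports.

(** If Fac(x) is contained in S^2 with at most B words of each length in S, a
    factor of length n is given by a cutting point and two words of S of the
    resulting lengths, so p_x(n) <= (n + 1) B^2 ([complexity_sqr]).

    Conversely, let p_x(n) <= C n. A family of positions q of x yields
    the words of x ending at q and those starting at q, that is, at most two
    words of each length for each q. So it is enough to find, at each scale n,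
    a number of positions bounded independently of n such that every factor of
    length between 4n and 8n has an occurrence straddling one of them, with at
    least n letters on each side ([straddling_positions]). The words collected
    at scale n then have length between n and 8n, hence a given length is
    concerned by at most three of the dyadic scales n = 2^k, and the language
    of all collected words has bounded complexity.

    To find the positions, choose a length L between 16n and 32n with at most
    2C right special factors: it exists because every right special factor of
    length L contributes to p_x(L + 1) - p_x(L), and these differences add up
    to at most 32 C n over 16n values of L. The walk c(p) = x_p ... x_(p+L-1)
    on the at most 32 C n factors of length L moves deterministically except at
    right special vertices. Such a walk has a hitting set of bounded size for
    its windows of 2n consecutive steps ([hitting_set]): besides the right
    special vertices and one vertex visited infinitely often, take the vertices
    whose distance to these along the walk is a multiple of n and which are
    reached by n deterministic steps. Each of them accounts for n vertices of
    its own, so there are at most 32 C of them. One occurrence of each vertex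
    of the hitting set gives the positions: as L exceeds the length of the
    factors, the vertex hit determines the factor around the cutting point. *)

(** * Hitting sets for almost deterministic walks *)

Definition prop_set (V : finType) (P : V -> Prop) : {set V} :=
  [set v | `[< P v >]]%SET.

Lemma prop_setP (V : finType) (P : V -> Prop) (v : V) :
  reflect (P v) (v \in prop_set V P).
Proof. by rewrite /prop_set finset.in_set; exact: asboolP. Qed.

Arguments prop_set {V} P.
Arguments prop_setP {V P v}.

(** This vertex is what makes the distance in [hitting_set] always finite,
    also when the walk eventually stays in a cycle of deterministic vertices. *)
Lemma visited_infinitely_often (V : finType) (c : nat -> V) :
  exists z, forall p, exists2 q, p <= q & c q = z.
Proof.
apply: contrapT => none.
have /choice[f fP] : forall z, exists p, forall q, p <= q -> c q <> z.
  move=> z; apply: contrapT => often; apply: none; exists z => p.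
  apply: contrapT => no_q; apply: often; exists p => q pq cq.
  by apply: no_q; exists q.
pose m := \max_z f z.
by apply: (fP (c m) m) => //; exact: leq_bigmax.
Qed.

Section Hitting.
Variables (V : finType) (c : nat -> V) (R : {set V}) (n : nat).
Hypothesis n_gt0 : 0 < n.
Hypothesis c_det : forall p q, c p = c q -> c p \notin R -> c p.+1 = c q.+1.

(** Let R' be R together with a vertex visited infinitely often. The vertices
    added to R' are those whose distance to R' is a multiple of n and which the
    walk reaches after n consecutive vertices outside R'. These blocks of n
    vertices are pairwise disjoint: a common vertex has one distance to R',
    whose residue modulo n gives its rank in the block, and following the walk
    from it leads to a single marked vertex. Hence n times the number of marked
    vertices is at most the number of vertices visited. *)
Lemma hitting_set :
  exists2 H : {set V},
    #|H| * n <= #|R|.+1 * n + #|prop_set (fun v => exists p, c p = v)| &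
    forall p, exists2 j, j < n.*2 & c (p + j) \in H.
Proof.
have [z zP] := visited_infinitely_often _ c.
pose R' := z |: R.
have reach p : exists d, c (p + d) \in R'.
  by have [q pq cq] := zP p; exists (q - p); rewrite subnKC // cq finset.setU11.
pose d p := ex_minn (reach p).
have dR p : c (p + d p) \in R' by rewrite /d; case: ex_minnP.
have d_min p j : c (p + j) \in R' -> d p <= j.
  by rewrite /d; case: ex_minnP => m _; apply.
have d_shift p j : j <= d p -> d (p + j) = d p - j.
  move=> jd; apply/eqP; rewrite eqn_leq d_min ?leq_subLR ?d_min //.
    by rewrite addnA dR.
  by rewrite -addnA subnKC // dR.
have follow p q j : c p = c q -> j <= d p -> c (p + j) = c (q + j).
  move=> cpq; elim: j => [|j IHj] jd; first by rewrite !addn0.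
  rewrite !addnS; apply: c_det; first exact: IHj (ltnW jd).
  apply/negP => cR; have := d_min p j.
  by rewrite finset.in_setU1 cR orbT leqNgt jd => /(_ isT).
have d_eq p q : c p = c q -> d p = d q.
  wlog dpq : p q / d p <= d q => [wl cpq|cpq].
    by case: (leqP (d p) (d q)) => [|/ltnW] h; [exact: wl|exact/esym/wl].
  by apply/eqP; rewrite eqn_leq dpq d_min // -(follow p) // dR.
(* [n <= d p] says that the n vertices from p to p + n - 1 avoid R'. *)
pose marks v p := [/\ c (p + n) = v, n <= d p & n %| d p].
pose M := prop_set (fun v => exists p, marks v p).
have /choice[rep repP] : forall v, exists p, v \in M -> marks v p.
  move=> v; have [[p vp]|nv] := pselect (exists p, marks v p).
    by exists p.
  by exists 0 => /prop_setP.
exists (R' :|: M); last first.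
  move=> p; have [[j [jn jR]]|no_R] :=
    pselect (exists j, j < n.*2 /\ c (p + j) \in R').
    by exists j => //; rewrite finset.in_setU jR.
  (* The window avoids R', so d decreases by one at each step and takes a
     multiple of n as value in the first half; n steps later is a mark. *)
  have dp : n.*2 <= d p.
    by rewrite leqNgt; apply/negP => ?; apply: no_R; exists (d p); split.
  have jn := ltn_pmod (d p) n_gt0; exists (d p %% n + n); first by lia.
  rewrite finset.in_setU addnA; apply/orP; right; apply/prop_setP.
  exists (p + d p %% n); split=> //; rewrite d_shift ?leq_mod //; first by lia.
  by rewrite {1}(divn_eq (d p) n) addnK dvdn_mull.
have cardM : #|M| * n <= #|prop_set (fun v => exists p, c p = v)|.
  rewrite -[X in _ * X]card_ord -cardsT -cardsX.
  rewrite -(card_in_imset (f := fun vj : V * 'I_n => c (rep vj.1 + vj.2))).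
    apply/subset_leq_card/fintype.subsetP => _ /imsetP[[v j] _ ->].
    by apply/prop_setP; eexists.
  move=> [v i] [w j]; rewrite !finset.in_setX => /andP[+ _] /andP[+ _] /=.
  move=> /repP[cv nv dv] /repP[cw nw dw] /[dup] ceq /d_eq.
  have := ltn_ord i; have := ltn_ord j => jn i_n.
  rewrite !d_shift; [|lia|lia].
  move: dv dw => /dvdnP[a da] /dvdnP[b db] deq.
  have ij : i = j :> nat.
    have : b * n + i = a * n + j by lia.
    by move/(congr1 (modn^~ n)); rewrite !modnMDl !modn_small.
  have -> : j = i by exact/val_inj.
  congr pair; rewrite -cv -cw -(subnKC (ltnW i_n)) !addnA; apply: follow.
    by rewrite ceq ij.
  by rewrite d_shift; lia.
apply: leq_trans (leq_mul (leq_card_setU _ _) (leqnn n)) _.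
rewrite mulnDl leq_add // leq_mul2r cardsU1; apply/orP; right.
by rewrite -add1n leq_add2r leq_b1.
Qed.
End Hitting.

(** * Factors of an infinite word *)

Section Blocks.
Variables (A : finType) (x : nat -> A).

Definition block (a N : nat) : N.-tuple A := [tuple x (a + i) | i < N].

Lemma block_eqP a b N :
  block a N = block b N <-> forall i, i < N -> x (a + i) = x (b + i).
Proof.
split=> [eq_ab i iN|eq_ab]; last first.
  by apply/eq_from_tnth => i; rewrite !tnth_mktuple eq_ab.
have := congr1 (fun w => tnth w (Ordinal iN)) eq_ab.
by rewrite !tnth_mktuple.
Qed.

Lemma block_sub a b N i M :
  i + M <= N -> block a N = block b N -> block (a + i) M = block (b + i) M.
Proof.
move=> iMN /block_eqP eq_ab; apply/block_eqP => j jM.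
by rewrite -!addnA eq_ab //; lia.
Qed.

Lemma val_block a N : tval (block a N) = [seq x k | k <- iota a N].
Proof.
apply: (@eq_from_nth _ (x 0)) => [|i].
  by rewrite size_tuple size_map size_iota.
rewrite size_tuple => iN; rewrite (nth_map 0) ?size_iota // nth_iota //.
by rewrite -(tnth_nth _ _ (Ordinal iN)) tnth_mktuple.
Qed.

Lemma cat_block a M N :
  tval (block a M) ++ tval (block (a + M) N) = tval (block a (M + N)).
Proof. by rewrite !val_block -map_cat iotaD. Qed.

Lemma mem_Fac (w : seq A) :
  w \in Fac x <-> exists a, w = tval (block a (size w)).
Proof.
rewrite in_setE /Fac /=; split=> [[->|[i [j [ij wE]]]]|[a ->]].
- by exists 0; rewrite val_block.
- by exists i; rewrite val_block wE size_map size_iota.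
case: (size w) => [|N]; first by left; rewrite val_block.
right; exists a, (a + N); rewrite leq_addr val_block; split=> //.
by rewrite /index_iota -addnS addKn.
Qed.

Definition blocks N := prop_set (fun w : N.-tuple A => exists a, block a N = w).

Lemma factor_complexityE N : factor_complexity x N = #|blocks N|.
Proof.
apply: eq_card => w; rewrite inE /=; apply/idP/prop_setP.
  by move=> /mem_Fac[a]; rewrite size_tuple => wE; exists a; apply/val_inj/esym.
by move=> [a <-]; apply/mem_Fac; exists a; rewrite size_tuple.
Qed.

Definition right_special L := prop_set (fun w : L.-tuple A =>
  exists a b, [/\ block a L = w, block b L = w & block a L.+1 <> block b L.+1]).

(** Deleting the last letter maps the factors of length L + 1 onto those of
    length L, because x is infinite, and the fibre of a right special factor
    has at least two elements. *)
Lemma card_right_special L :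
  #|blocks L| + #|right_special L| <= #|blocks L.+1|.
Proof.
pose pre (w : L.+1.-tuple A) : L.-tuple A :=
  [tuple tnth w (widen_ord (leqnSn L) i) | i < L].
have preE a : pre (block a L.+1) = block a L.
  by apply: eq_from_tnth => i; rewrite !tnth_mktuple.
have preB w : w \in blocks L.+1 -> pre w \in blocks L.
  by move=> /prop_setP[a <-]; apply/prop_setP; exists a; rewrite preE.
have RB : right_special L \subset blocks L.
  apply/fintype.subsetP => w /prop_setP[a [b [aw _ _]]].
  by apply/prop_setP; exists a.
rewrite -(sum1_card (mem (blocks L.+1))) (partition_big pre _ preB) /=.
rewrite -(sum1_card (mem (blocks L))).
rewrite -[in X in _ + X](finset.setIidPr RB) -sum1_card.
under [X in _ + X]eq_bigl do rewrite finset.in_setI.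
rewrite big_mkcondr -big_split leq_sum //= => w /prop_setP[a aw].
rewrite sum1_card; case: ifPn => [|_]; last first.
  rewrite addn0; apply/card_gt0P; exists (block a L.+1).
  by rewrite unfold_in preE aw eqxx andbT; apply/prop_setP; exists a.
move=> /prop_setP[b [c [bw cw /eqP bc]]].
have <- : #|[set block b L.+1; block c L.+1]%SET| = 1 + 1 by rewrite cards2 bc.
apply/subset_leq_card/fintype.subsetP => v; rewrite finset.in_set2.
case/orP=> /eqP ->; rewrite unfold_in preE ?bw ?cw eqxx andbT;
  by apply/prop_setP; eexists.
Qed.

Variable C : nat.
Hypothesis linear : forall n, 0 < n -> #|blocks n| <= C * n.

(** Otherwise p_x would grow by at least 2C + 1 at each of the M lengths from M
    to 2M, and p_x(2M) would exceed 2CM. *)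
Lemma few_right_special M : 0 < M ->
  exists L, [/\ M <= L, L < M.*2 & #|right_special L| <= C.*2].
Proof.
move=> M0; apply: contrapT => many.
suff grow t : t <= M -> #|blocks M| + t * C.*2.+1 <= #|blocks (M + t)|.
  have := grow M (leqnn M); have := @linear (M + M).
  by rewrite addn_gt0 M0 => /(_ isT); nia.
elim: t => [|t IHt] tM; first by rewrite addn0 mul0n addn0.
have := IHt (ltnW tM); have := card_right_special (M + t).
rewrite addnS mulSn; set p := #|right_special _|.
suff : C.*2 < p by lia.
by rewrite ltnNge; apply/negP => pC; apply: many; exists (M + t); split; lia.
Qed.

(** * Positions straddled by all the factors of a given scale *)

(** At most 2C right special vertices, one recurrent vertex, 32 C marked
    vertices, and nine positions near the beginning of x. *)
Definition scale_bound := C.*2.+1 + 32 * C + 9.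

(** The vertices hitting the walk provide the positions, except for the factors
    starting before position 7n: the walk has no vertex early enough for them,
    and they are cut at a multiple of n instead. *)
Lemma straddling_positions n : 0 < n -> exists2 Q : seq nat,
  size Q <= scale_bound &
  forall a N, 4 * n <= N -> N <= 8 * n -> exists q i,
    [/\ q \in Q, n <= i, i <= 3 * n, i <= q & block a N = block (q - i) N].
Proof.
move=> n0.
have [L [nL Ln RL]] := few_right_special (16 * n) ltac:(by rewrite muln_gt0 n0).
have det p q : block p L = block q L -> block p L \notin right_special L ->
    block p.+1 L = block q.+1 L.
  move=> pq nR; have pqS : block p L.+1 = block q L.+1.
    apply: contrapT => ne; move/negP: nR; apply; apply/prop_setP.
    by exists p, q.
  by have := block_sub p q L.+1 1 L (leqnn _) pqS; rewrite !addn1.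
have [H cardH hitH] := hitting_set _ (fun p => block p L) _ _ n0 det.
have {}cardH : #|H| <= C.*2.+1 + 32 * C.
  have := linear L ltac:(lia); move: cardH; rewrite -/(blocks L); nia.
have /choice[rep repP] : forall h, exists p, h \in H ->
    (exists q, block q L = h) -> block p L = h.
  move=> h; have [[p ph]|no] := pselect (exists q, block q L = h).
    by exists p.
  by exists 0.
exists ([seq rep h + 8 * n | h <- enum H] ++ [seq n * t | t <- iota 0 9]).
  by rewrite size_cat !size_map size_iota -cardE leq_add2r.
move=> a N N4 N8; have [an|an] := leqP (7 * n) a.
  (* The cutting point lies 8n letters after the start of the vertex hit, which
     is less than 2n letters after a - 7n: so it is between n and 3n letters
     after a, and the whole factor is within the L >= 16n letters of the
     vertex. *)
  have [j j2 jH] := hitH (a - 7 * n).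
  exists (rep (block (a - 7 * n + j) L) + 8 * n), (n + j); split; try lia.
    rewrite mem_cat; apply/orP; left; apply/mapP.
    by exists (block (a - 7 * n + j) L); rewrite // mem_enum.
  have := repP _ jH (ex_intro _ _ erefl); set r := rep _ => rE.
  have -> : a = a - 7 * n + j + (7 * n - j) by lia.
  have -> : r + 8 * n - (n + j) = r + (7 * n - j) by lia.
  by apply: block_sub (esym rE); lia.
have := divn_eq a n; have := ltn_pmod a n0 => an0 aE.
exists (n * (a %/ n + 2)), (n * (a %/ n + 2) - a); split; try nia.
  rewrite mem_cat; apply/orP; right; apply/mapP; exists (a %/ n + 2) => //.
  by rewrite mem_iota add0n /=; nia.
by rewrite subKn //; nia.
Qed.

(** Words of length less than 4, too short for the scale n = 1, are all put in
    S. Any other factor is cut at the scale 2^k which is a quarter of its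
    length, rounded down to a power of two. *)
Lemma bounded_language_of_linear : exists (S : language A) (B : nat),
  (forall n, 4 <= n -> complexity S n <= B) /\ (Fac x `<=` lang_sqr S)%classic.
Proof.
have /choice[Q QP] : forall k, exists Q : seq nat, size Q <= scale_bound /\
  forall a N, 4 * 2 ^ k <= N -> N <= 8 * 2 ^ k -> exists q i,
    [/\ q \in Q, 2 ^ k <= i, i <= 3 * 2 ^ k, i <= q &
        block a N = block (q - i) N].
  move=> k; have [|Q sQ QP] := straddling_positions (2 ^ k).
    by rewrite expn_gt0.
  by exists Q.
pose pieces k j :=
  [seq block (q - j) j | q <- Q k] ++ [seq block q j | q <- Q k].
pose S : language A := (fun w => size w < 4 \/ exists k,
  [/\ 2 ^ k <= size w, size w < 2 ^ (k + 3) &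
      w \in map val (pieces k (size w))]).
exists S, (3 * scale_bound.*2); split=> [n n4|w].
  pose t := trunc_log 2 n.
  have n_t : 2 ^ t <= n < 2 ^ t.+1 by apply: trunc_log_bounds; lia.
  (* Only the scales 2^k with k in {t - 2, t - 1, t} have pieces of length n. *)
  pose all_pieces := flatten [seq pieces k n | k <- iota (t - 2) 3].
  have size_pieces k : size (pieces k n) <= scale_bound.*2.
    by rewrite size_cat !size_map addnn leq_double; case: (QP k).
  apply: (@leq_trans (size all_pieces)); last first.
    rewrite /all_pieces /= cats0 !(size_cat (pieces _ _)).
    by rewrite !mulSn mul0n addn0 !leq_add.
  apply: leq_trans (card_size _); apply/subset_leq_card/fintype.subsetP => w.
  rewrite !inE /S size_tuple => -[|[k [kn nk wk]]].
    lia.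
  apply/flattenP; exists (pieces k n); last first.
    by move: wk => /mapP[v vk /val_inj ->].
  apply/mapP; exists k => //; rewrite mem_iota.
  have : k <= t by apply: trunc_log_max.
  have : t < k + 3.
    by rewrite -(@ltn_exp2l 2) //; apply: leq_ltn_trans nk; case/andP: n_t.
  lia.
move/mem_set/mem_Fac => [a wE]; have [w4|w4] := ltnP (size w) 4.
  by exists w; [left|exists [::]; [left|rewrite cats0]].
pose N := size w; pose k := trunc_log 2 N - 2.
have kN : 4 * 2 ^ k <= N < 8 * 2 ^ k.
  have t2 : 2 <= trunc_log 2 N by apply: trunc_log_max.
  rewrite -[4]/(2 ^ 2) -[8]/(2 ^ 3) -!expnD -[3 + k]/(2 + k).+1 subnKC //.
  by apply: trunc_log_bounds => //; lia.
case/andP: kN => N4 N8.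
have [_ /(_ a N N4 (ltnW N8)) [q [i [qQ ki i3 iq aE]]]] := QP k.
exists (block (q - i) i).
  right; exists k; rewrite size_tuple expnD; split=> //; first lia.
  apply: map_f; rewrite mem_cat; apply/orP; left.
  by apply/mapP; exists q.
exists (block q (N - i)).
  right; exists k; rewrite size_tuple expnD; split; [lia|lia|].
  apply: map_f; rewrite mem_cat; apply/orP; right.
  by apply/mapP; exists q.
have iN : i <= N by lia.
rewrite [RHS]wE -/N aE.
by have := cat_block (q - i) i (N - i); rewrite subnK // subnKC.
Qed.

End Blocks.

(** * Squares of languages of bounded complexity *)

Lemma complexity_sqr (A : finType) (a0 : A) (S L : language A) (C : nat) :
  (forall n, complexity S n <= C) -> (L `<=` lang_sqr S)%classic ->
  forall n, complexity L n <= n.+1 * C ^ 2.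
Proof.
move=> SC LS n.
pose words m := prop_set (fun w : m.-tuple A => S (tval w)).
have wordsE m : #|words m| <= C.
  apply: leq_trans (SC m); rewrite leq_eqVlt; apply/orP; left; apply/eqP.
  apply: eq_card => w; rewrite [RHS]inE.
  by apply/prop_setP/idP; rewrite in_setE.
pose glue (i : 'I_n.+1) (uv : i.-tuple A * (n - i).-tuple A) : n.-tuple A :=
  [tuple nth a0 (uv.1 ++ uv.2) k | k < n].
pose cut i := glue i @: (finset.setX (words i) (words (n - i))).
have cutC i : #|cut i| <= C ^ 2.
  by apply: leq_trans (leq_imset_card _ _) _; rewrite cardsX leq_mul.
apply: (@leq_trans #|\bigcup_i cut i|%SET).
  apply/subset_leq_card/fintype.subsetP => w.
  rewrite inE => /LS[u uS [v vS uv]].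
  have suv : size u + size v = n by rewrite -size_cat uv size_tuple.
  have un : size u < n.+1 by lia.
  apply/finset.bigcupP; exists (Ordinal un) => //.
  have sv : size v == n - size u by apply/eqP; lia.
  apply/imsetP; exists (in_tuple u, Tuple sv).
    by rewrite finset.in_setX; apply/andP; split; apply/prop_setP.
  apply: eq_from_tnth => k; rewrite tnth_mktuple (tnth_nth a0) /=.
  by rewrite uv.
have -> : n.+1 * C ^ 2 = \sum_(i < n.+1) C ^ 2.
  by rewrite sum_nat_const card_ord.
elim/big_ind2: _ => [|D p E q Dp Eq|i _]; first by rewrite cards0.
  by apply: leq_trans (leq_card_setU _ _) _; exact: leq_add.
exact: cutC.
Qed.

(** * Asymptotic conditions as uniform bounds on naturals *)

Lemma eventually_bounded (f : nat -> nat) (N B : nat) :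
  (forall n, N <= n -> f n <= B) -> exists B', forall n, f n <= B'.
Proof.
move=> fB; exists (B + \sum_(i < N) f i) => n.
have [/fB nB|nN] := leqP N n; first exact: leq_trans nB (leq_addr _ _).
by rewrite (bigD1 (Ordinal nN)) //=; lia.
Qed.

Lemma limn_esup_fin_natP (R : realType) (f : nat -> nat) :
  (limn_esup (fun n => ((f n)%:R : R)%:E) < +oo)%E <->
  exists B, forall n, f n <= B.
Proof.
split=> [/ereal_inf_lt[_ [V [N _ NV] <-]] sup_fin|[B fB]].
  have fV n : N <= n ->
      (((f n)%:R : R)%:E <= ereal_sup [set ((f n)%:R : R)%:E | n in V])%E.
    by move=> Nn; apply: ereal_sup_ubound; exists n => //; exact: NV.
  case: (ereal_sup _) sup_fin fV => [r _ fV|//|_ /(_ N (leqnn N))//].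
  apply: (@eventually_bounded f N (Num.truncn r)) => n /fV.
  by rewrite lee_fin => fr; rewrite -(@natrK R (f n)) le_truncn.
apply: (@le_lt_trans _ _ ((B%:R : R)%:E)); last exact: ltry.
apply: (@le_trans _ _ (ereal_sup (range (fun n => ((f n)%:R : R)%:E)))).
  by apply: ereal_inf_lbound; exists setT => //; exact: filterT.
by apply: ge_ereal_sup => _ [n _ <-]; rewrite lee_fin ler_nat.
Qed.

Local Open Scope classical_set_scope.

Lemma linear_natP (R : realType) (f : nat -> nat) :
  (fun n : nat => (f n)%:R : R^o)%R =O_\oo (fun n : nat => n%:R : R^o)%R <->
  exists C, forall n, 0 < n -> f n <= C * n.
Proof.
split=> [/eqO_exP[k k0 [N _ fN]]|[C fC]]; last first.
  apply/eqO_exP; exists (C.+1%:R)%R; first exact: ltr0Sn.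
  exists 1 => // n /= n1; rewrite !normr_nat -natrM ler_nat.
  by apply: leq_trans (fC n n1) _; rewrite leq_mul2r leqnSn orbT.
(* The finitely many n outside the range of the bound only add a constant B to
   f n, at most B n for n positive. *)
have [B fB] : exists B, forall n, f n - (Num.truncn k).+1 * n <= B.
  apply: (@eventually_bounded _ N 0) => n /fN; rewrite /= !normr_nat => fk.
  rewrite leqn0 subn_eq0 -(ler_nat R); apply: le_trans fk _.
  by rewrite natrM ler_wpM2r ?ler0n // ltW // truncnS_gt.
exists ((Num.truncn k).+1 + B) => n n0; have := fB n.
by rewrite leq_subLR mulnDl => /leq_trans; apply; rewrite leq_add2l leq_pmulr.
Qed.

Local Open Scope ring_scope.

Theorem theorem1 (R : realType) (A : finType) (A_nonempty : (0 < #|A|)%N)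
    (x : nat -> A) :
  (fun n : nat => (factor_complexity x n)%:R : R^o) =O_\oo
    (fun n : nat => n%:R : R^o)
  <-> exists S : language A,
        bounded_complexity R S /\ Fac x `<=` lang_sqr S.
Proof.
rewrite linear_natP; split=> [[C linear]|[S [/limn_esup_fin_natP[B SB] xS]]].
  have [|S [B [SB xS]]] := @bounded_language_of_linear A x C.
    by move=> n n0; rewrite -factor_complexityE; exact: linear.
  exists S; split=> //; apply/limn_esup_fin_natP.
  exact: eventually_bounded SB.
exists (2 * B ^ 2)%N => n n0.
by apply: leq_trans (complexity_sqr _ (x 0) _ _ _ SB xS n) _; nia.
Qed.
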